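(* Let $K$ be a finite regular CW complex, $L$ a subcomplex of $K$, and $f:K\to\mathbb{R}^k$ a multidimensional discrete Morse (MDM) function on $K$. Then the restriction $f|_L:L\to\mathbb{R}^k$ is an MDM function on $L$. Moreover, if $\sigma\in L$ is a critical $p$-cell of $f$, then $\sigma$ is critical for $f|_L$.
   Context: A finite regular CW complex $K$ is identified with its set of open cells; $K_p$ is the set of $p$-cells. For distinct cells, $\sigma\subset\tau$ means that $\sigma$ is contained in the closure of $\tau$. On $\mathbb{R}^k$, $a\preceq b$ means $a_i\le b_i$ for all $i$, and $a\prec b$ means $a\preceq b$ and $a\ne b$. For $f:K\to\mathbb{R}^k$ (a function on cells) and $\sigma\in K_p$, put $H_f(\sigma)=\{\beta\in K_{p+1}:\beta\supset\sigma,\ f(\beta)\preceq f(\sigma)\}$ and $T_f(\sigma)=\{\alpha\in K_{p-1}:\alpha\subset\sigma,\ f(\alpha)\succeq f(\sigma)\}$. $f$ is an MDM function on $K$ if for every $p$ and every $\sigma\in K_p$: (1) $|H_f(\sigma)|\le 1$; (2) $|T_f(\sigma)|\le1$; (3) if $\beta\in K_{p+1}$, $\beta\supset\sigma$, $\beta\notin H_f(\sigma)$, then $f(\beta)\succ f(\sigma)$; (4) if $\alpha\in K_{p-1}$, $\alpha\subset\sigma$, $\alpha\notin T_f(\sigma)$, then $f(\alpha)\prec f(\sigma)$. A cell $\sigma$ is critical for $f$ if $|H_f(\sigma)|=|T_f(\sigma)|=0$. For a function on the cells of a subcomplex $L$, the same definitions are used with $L$ in place of $K$. *)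

(* Defs.v *)
From HB Require Import structures.
From mathcomp Require Import all_boot all_order all_algebra.
From mathcomp Require Import all_classical all_reals all_analysis.

Set Implicit Arguments.
Unset Strict Implicit.
Unset Printing Implicit Defensive.

Import Order.TTheory GRing.Theory Num.Theory.
Import numFieldNormedType.Exports.

Local Open Scope classical_set_scope.
Local Open Scope ring_scope.

Section UnitDisk.
Variables (R : realType) (n : nat).

(* Euclidean balls: the library norm on 'rV[R]_n is the sup norm. *)
Definition unit_disk : set 'rV[R]_n := [set x | \sum_i x 0 i ^+ 2 <= 1].
Definition open_disk : set 'rV[R]_n := [set x | \sum_i x 0 i ^+ 2 < 1].
Definition unit_sphere : set 'rV[R]_n := [set x | \sum_i x 0 i ^+ 2 = 1].

End UnitDisk.
Arguments unit_disk : clear implicits.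
Arguments open_disk : clear implicits.
Arguments unit_sphere : clear implicits.

Definition homeomorphism_on (T U : topologicalType) (A : set T) (B : set U)
    (phi : T -> U) : Prop :=
  [/\ {within A, continuous phi}, phi @` A = B &
      exists2 psi : U -> T, {within B, continuous psi} &
        forall x, A x -> psi (phi x) = x].

(* The weak topology axiom is omitted: it is automatic for finitely many
   cells, each having a compact closure. *)
Record finRegularCW (R : realType) (X : topologicalType) := FinRegularCW {
  cell : finType;
  dim : cell -> nat;
  open_cell : cell -> set X;
  cw_hausdorff : hausdorff_space X;
  cw_cover : \bigcup_s open_cell s = setT;
  cw_disjoint : trivIset setT open_cell;
  cw_char : forall s, exists phi : 'rV[R]_(dim s) -> X,
    [/\ homeomorphism_on (unit_disk R (dim s)) (closure (open_cell s)) phi,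
        phi @` open_disk R (dim s) = open_cell s &
        phi @` unit_sphere R (dim s) `<=`
          \bigcup_(t in [set t | (dim t < dim s)%N]) open_cell t] }.

Section Faces.
Variables (R : realType) (X : topologicalType) (K : finRegularCW R X).

Definition pcells (p : nat) : {set cell K} := [set s | dim s == p].

Definition face : rel (cell K) := fun s t =>
  (s != t) && `[< open_cell s `<=` closure (open_cell t) >].

Definition carrier (L : {set cell K}) : set X :=
  \bigcup_(s in [set` L]) open_cell s.

Definition is_subcomplex (L : {set cell K}) : Prop :=
  forall s, s \in L -> closure (open_cell s) `<=` carrier L.

End Faces.

Section Subcomplex.
Variables (R : realType) (X : topologicalType) (K : finRegularCW R X).
Variables (L : {set cell K}) (HL : is_subcomplex L).

Let LX : topologicalType := set_type (carrier L).
Let LC : finType := {s : cell K | s \in L}.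
Let Lopen (s : LC) : set LX := set_val @^-1` open_cell (val s).

Lemma subcomplex_hausdorff : hausdorff_space LX.
Proof.
have := @cw_hausdorff _ _ K; rewrite !open_hausdorff => h x y xy.
have /h[[A B] /= [xA yB] [oA oB AB]] : set_val x != set_val y.
  by apply: contra xy => /eqP /val_inj ->.
exists (set_val @^-1` A, set_val @^-1` B) => /=.
  by rewrite !inE in xA yB *.
split; [by exists A|by exists B|].
by rewrite -preimage_setI (eqP AB) preimage_set0.
Qed.

Lemma subcomplex_cover : \bigcup_s Lopen s = setT.
Proof.
apply/seteqP; split=> // x _.
have [s sL xs] : carrier L (set_val x) := set_valP x.
by exists (exist _ s sL).
Qed.

Lemma subcomplex_disjoint : trivIset setT Lopen.
Proof.
move=> s t _ _ [x [xs xt]]; apply: val_inj.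
by apply: (@cw_disjoint _ _ K) => //; exists (set_val x).
Qed.

Lemma subcomplex_closure (s : LC) :
  closure (Lopen s) = set_val @^-1` closure (open_cell (val s)).
Proof.
apply/seteqP; split=> x cx.
  move=> B /(@initial_continuous LX X set_val x) /cx[y [ys By]].
  by exists (set_val y).
move=> B [_ [[W oW <-] Wx WB]].
have /cx[y [ys Wy]] : nbhs (set_val x) W by exact: open_nbhs_nbhs.
have yL : y \in carrier L by apply/mem_set; exists (val s) => //; exact: valP.
by exists (exist _ y yL); split => //; exact: WB.
Qed.

Lemma subcomplex_char (s : LC) : exists phi : 'rV[R]_(dim (val s)) -> LX,
  [/\ homeomorphism_on (unit_disk R (dim (val s))) (closure (Lopen s)) phi,
      phi @` open_disk R (dim (val s)) = Lopen s &
      phi @` unit_sphere R (dim (val s)) `<=`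
        \bigcup_(t in [set t : LC | (dim (val t) < dim (val s))%N]) Lopen t].
Proof.
have [phi [[cphi im_phi [psi cpsi phiK]] int_phi bd_phi]] := cw_char (val s).
set n := dim (val s) in phi cphi im_phi psi cpsi phiK int_phi bd_phi *.
have D_L x : unit_disk R n x -> phi x \in carrier L.
  by move=> Dx; apply/mem_set/(HL (valP s)); rewrite -im_phi; exists x.
have D0 : unit_disk R n 0.
  by rewrite /unit_disk /= big1 ?ler01 // => i _; rewrite mxE expr0n.
pose phi' x : LX := match pselect (unit_disk R n x) with
  | left Dx => exist _ (phi x) (D_L x Dx)
  | right _ => exist _ (phi 0) (D_L 0 D0) end.
have phi'E x : unit_disk R n x -> set_val (phi' x) = phi x.
  by rewrite /phi'; case: pselect.
have OD x : open_disk R n x -> unit_disk R n x by move=> /ltW.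
have SD x : unit_sphere R n x -> unit_disk R n x.
  by rewrite /unit_sphere /unit_disk /= => ->.
exists phi'; split; first split.
- apply/subspace_sigL_continuousP; move/subspace_sigL_continuousP: cphi => cphi.
  apply: continuous_comp_initial.
  suff -> : set_val \o sigL (unit_disk R n) phi' = sigL (unit_disk R n) phi by [].
  by apply/funext => x /=; apply: phi'E; exact: set_valP.
- rewrite subcomplex_closure -im_phi; apply/seteqP; split=> [_ [x Dx <-]|y [x Dx xy]].
    by exists x => //; rewrite phi'E.
  by exists x => //; apply: val_inj; rewrite -[LHS]/(set_val _) phi'E.
- exists (psi \o set_val) => [|x Dx]; last by rewrite /= phi'E // phiK.
  rewrite subcomplex_closure; apply/subspace_sigL_continuousP.
  move/subspace_sigL_continuousP: cpsi => cpsi.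
  set A := closure _ in cpsi *.
  pose g (x : set_type (set_val @^-1` A : set LX)) : set_type A :=
    exist _ (set_val (set_val x)) (mem_set (set_valP x)).
  have -> : sigL (set_val @^-1` A) (psi \o set_val) = sigL A psi \o g by [].
  move=> x; apply: continuous_comp; last exact: cpsi.
  apply: (@continuous_comp_initial (set_type A) _ X set_val g) => {}x.
  have -> : set_val \o g = set_val \o set_val by [].
  apply: continuous_comp.
    exact: (@initial_continuous (set_type (set_val @^-1` A)) LX set_val).
  exact: (@initial_continuous LX X set_val).
- rewrite /Lopen -int_phi; apply/seteqP; split=> [_ [x Dx <-]|y [x Dx xy]].
    by exists x => //; rewrite phi'E //; exact: OD.
  by exists x => //; apply: val_inj; rewrite -[LHS]/(set_val _) phi'E //; exact: OD.
- move=> _ [x Sx <-]; have Dx := SD x Sx.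
  case: (bd_phi (phi x)) => [|t ts xt]; first by exists x.
  have [u uL xu] := set_mem (D_L x Dx).
  have tu : t = u by apply: (@cw_disjoint _ _ K) => //; exists (phi x).
  have tL : t \in L by rewrite tu.
  by exists (exist _ t tL) => //; rewrite /Lopen /= phi'E.
Qed.

Definition subcomplexCW : finRegularCW R (set_type (carrier L)) :=
  @FinRegularCW R LX LC (fun s => dim (val s)) Lopen subcomplex_hausdorff
    subcomplex_cover subcomplex_disjoint subcomplex_char.

Definition restrict_cells (T : Type) (f : cell K -> T) : cell subcomplexCW -> T :=
  fun s => f (val (s : LC)).

Definition in_subcomplex (s : cell K) (sL : s \in L) : cell subcomplexCW :=
  exist _ s sL.

End Subcomplex.

Arguments restrict_cells {R X K L} HL {T} f s.
Arguments in_subcomplex {R X K L} HL {s} sL.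

Section VectorOrder.
Variables (R : realType) (k : nat).

Definition vle (a b : 'rV[R]_k) : bool := [forall i, a 0 i <= b 0 i].
Definition vlt (a b : 'rV[R]_k) : bool := vle a b && (a != b).

End VectorOrder.

Section MDM.
Variables (R : realType) (X : topologicalType) (K : finRegularCW R X).
Variables (k : nat) (f : cell K -> 'rV[R]_k).

Definition Hset (s : cell K) : {set cell K} :=
  [set b in pcells K (dim s).+1 | face s b && vle (f b) (f s)].

(* For dim s = 0 the condition (dim a).+1 = dim s is void, so K_{-1} is empty. *)
Definition Tset (s : cell K) : {set cell K} :=
  [set a | [&& (dim a).+1 == dim s, face a s & vle (f s) (f a)]].

Definition is_MDM : Prop := forall s : cell K,
  [/\ (#|Hset s| <= 1)%N,
      (#|Tset s| <= 1)%N,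
      forall b, dim b = (dim s).+1 -> face s b -> b \notin Hset s ->
        vlt (f s) (f b) &
      forall a, (dim a).+1 = dim s -> face a s -> a \notin Tset s ->
        vlt (f a) (f s)].

Definition critical (s : cell K) : Prop := #|Hset s| = 0%N /\ #|Tset s| = 0%N.

End MDM.

(* Main.v *)
Require Import Defs.
From mathcomp Require Import all_boot all_order all_algebra.
From mathcomp Require Import all_classical all_reals all_analysis.

(** Incidence between two cells of [L] is the same in [L] as in [K] ([face_subcomplex]), so [Hset]
    and [Tset] of the restriction at [s] are the parts lying in [L] of those of [f]. Bounds on their
    sizes, and emptiness, are thus inherited. A face or coface in [L] outside the smaller set is
    outside the larger one, so the strict inequalities carry over too. *)

Section Restriction.
Variables (R : realType) (X : topologicalType) (K : finRegularCW R X).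
Variables (L : {set cell K}) (HL : is_subcomplex L).

Definition in_complex (s : cell (subcomplexCW HL)) : cell K := \val s.

Lemma in_complex_inj : injective in_complex.
Proof. exact: val_inj. Qed.

(** Closure in the carrier is the trace of closure in [X], and open cells of [L] lie wholly in the
    carrier. *)
Lemma face_subcomplex (s t : cell (subcomplexCW HL)) :
  face s t = face (in_complex s) (in_complex t).
Proof.
rewrite /face (inj_eq in_complex_inj) /= subcomplex_closure; congr (_ && _).
apply/asboolP/asboolP => st x sx; last exact: st.
(* To use the inclusion known in the carrier, the point of [X] is lifted there. *)
have xL : x \in carrier L by apply/mem_set; exists (in_complex s) => //; exact: valP.
exact: (st (exist _ x xL)).
Qed.

Variables (k : nat) (f : cell K -> 'rV[R]_k).

(** Dimensions and values of [f] agree by conversion; only [face] needs transport. *)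
Lemma mem_Hset_restrict (s b : cell (subcomplexCW HL)) :
  (b \in Hset (restrict_cells HL f) s) =
  (in_complex b \in Hset f (in_complex s)).
Proof. by rewrite !inE face_subcomplex. Qed.

Lemma mem_Tset_restrict (s a : cell (subcomplexCW HL)) :
  (a \in Tset (restrict_cells HL f) s) =
  (in_complex a \in Tset f (in_complex s)).
Proof. by rewrite !inE face_subcomplex. Qed.

(** Inclusion of cells is injective; the bound can be strict, as cofaces outside [L] are lost. *)
Lemma card_Hset_restrict (s : cell (subcomplexCW HL)) :
  (#|Hset (restrict_cells HL f) s| <= #|Hset f (in_complex s)|)%N.
Proof.
rewrite -(card_imset _ in_complex_inj); apply/subset_leq_card/fintype.subsetP => b.
by case/imsetP=> c + ->; rewrite mem_Hset_restrict.
Qed.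

Lemma card_Tset_restrict (s : cell (subcomplexCW HL)) :
  (#|Tset (restrict_cells HL f) s| <= #|Tset f (in_complex s)|)%N.
Proof.
rewrite -(card_imset _ in_complex_inj); apply/subset_leq_card/fintype.subsetP => a.
by case/imsetP=> c + ->; rewrite mem_Tset_restrict.
Qed.

Lemma is_MDM_restrict : is_MDM f -> is_MDM (restrict_cells HL f).
Proof.
move=> Hf s; have [H1 T1 Hlt Tlt] := Hf (in_complex s); split.
- exact: leq_trans (card_Hset_restrict s) H1.
- exact: leq_trans (card_Tset_restrict s) T1.
(* Equality of memberships also transfers [b \notin Hset] to [K], as [Hlt] requires. *)
- by move=> b db; rewrite face_subcomplex mem_Hset_restrict; exact: Hlt.
- by move=> a da; rewrite face_subcomplex mem_Tset_restrict; exact: Tlt.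
Qed.

Lemma critical_restrict (s : cell (subcomplexCW HL)) :
  critical f (in_complex s) -> critical (restrict_cells HL f) s.
Proof.
move=> [H0 T0]; split; apply/eqP; rewrite -leqn0.
  by apply: leq_trans (card_Hset_restrict s) _; rewrite H0.
by apply: leq_trans (card_Tset_restrict s) _; rewrite T0.
Qed.

End Restriction.

Theorem lemma2p9 (R : realType) (X : topologicalType) (K : finRegularCW R X)
    (L : {set cell K}) (HL : is_subcomplex L) (k : nat)
    (f : cell K -> 'rV[R]_k) (Hf : is_MDM f) :
  is_MDM (restrict_cells HL f) /\
  (forall (p : nat) (s : cell K) (sL : s \in L),
     s \in pcells K p -> critical f s ->
     critical (restrict_cells HL f) (in_subcomplex HL sL)).
Proof.
split; first exact: is_MDM_restrict.
by move=> p s sL _ sc; exact: critical_restrict.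
Qed.
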